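(* Let $\mathbf B$ be an involutive bisemilattice carrying a faithful state $s$, topologised by $d_s$, with Booleanisation $\mathbf A_\infty$ topologised by $d_\infty$ and projection $\pi\colon B\to A_\infty$. The following are equivalent: (1) $\mathbf B=\mathbf A_\infty$, i.e. $\pi$ is a bijection (every $\sim$-class is a singleton); (2) $\pi$ is interior preserving, i.e. $\mathrm{Int}(\pi(X))=\pi(\mathrm{Int}(X))$ for every $X\subseteq B$; (3) for every section $\sigma\colon A_\infty\to B$ of $\pi$, the set $\sigma(A_\infty)$ is open in $B$; equivalently, it is closed in $B$; equivalently, it is $\pi$-saturated (i.e. $\sigma(A_\infty)=\pi^{-1}(\pi(\sigma(A_\infty)))$).
   Context: An involutive bisemilattice is an algebra $\mathbf B=\langle B,\wedge,\vee,',0,1\rangle$ of type $(2,2,1,0,0)$ satisfying $x\vee x\approx x$, $x\vee y\approx y\vee x$, $x\vee(y\vee z)\approx(x\vee y)\vee z$, $(x')'\approx x$, $x\wedge y\approx(x'\vee y')'$, $x\wedge(x'\vee y)\approx x\wedge y$, $0\vee x\approx x$, $1\approx 0'$. Every involutive bisemilattice is (canonically) the Płonka sum of a semilattice direct system of Boolean algebras, and $\mathbf B$ is identified with it: a join-semilattice $(I,\vee)$ with least element $i_0$, Boolean algebras $\mathbf A_i$ with pairwise disjoint universes, Boolean homomorphisms $p_{ij}\colon\mathbf A_i\to\mathbf A_j$ ($i\le j$) with $p_{ii}=\mathrm{id}$, $p_{ik}=p_{jk}\circ p_{ij}$; $B=\bigsqcup_iA_i$; for $a\in A_i$, $b\in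 A_j$, $k=i\vee j$: $a\wedge b=p_{ik}(a)\wedge^{\mathbf A_k}p_{jk}(b)$, $a\vee b=p_{ik}(a)\vee^{\mathbf A_k}p_{jk}(b)$; $a'$ computed in the algebra containing $a$; $0,1$ those of $\mathbf A_{i_0}$. $0_i$ is the bottom of $\mathbf A_i$. A state is a map $s\colon B\to[0,1]$ with $s(1)=1$ and $s(a\vee b)=s(a)+s(b)$ whenever $a\wedge b\in\{0_i:i\in I\}$; faithful if $s(a)>0$ for all $a\in B\setminus\{0_i:i\in I\}$ (this forces all $p_{ij}$ to be injective). Booleanisation: $a\sim b$ (for $a\in A_i,b\in A_j$) iff $p_{ik}(a)=p_{jk}(b)$ for some $k\ge i,j$; $\mathbf A_\infty=B/{\sim}$, $\pi(a)=[a]_\sim$. $\Phi(s)([b]_\sim)=s(b)$ defines a finitely additive probability measure on $\mathbf A_\infty$. With $x\triangle y=(x\wedge y')\vee(x'\wedge y)$: $d_s(a,b)=s(a\triangle b)$ and $d_\infty(x,y)=\Phi(s)(x\triangle y)$; topologies are those induced by these (pseudo)metrics. A section of $\pi$ is a continuous map $\sigma\colon A_\infty\to B$ with $\pi\circ\sigma=\mathrm{id}_{A_\infty}$. *)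

(* Defs.v *)
From HB Require Import structures.
From mathcomp Require Import all_boot all_order all_algebra.
From mathcomp Require Import all_classical all_reals all_analysis.

Set Implicit Arguments.
Unset Strict Implicit.
Unset Printing Implicit Defensive.

Import Order.Theory GRing.Theory Num.Theory.

HB.mixin Record isInvolutiveBisemilattice (B : Type) := {
  ibmeet : B -> B -> B;
  ibjoin : B -> B -> B;
  ibinv : B -> B;
  ib0 : B;
  ib1 : B;
  ibjoinxx : forall x, ibjoin x x = x;
  ibjoinC : forall x y, ibjoin x y = ibjoin y x;
  ibjoinA : forall x y z, ibjoin x (ibjoin y z) = ibjoin (ibjoin x y) z;
  ibinvK : forall x, ibinv (ibinv x) = x;
  ibmeetE : forall x y, ibmeet x y = ibinv (ibjoin (ibinv x) (ibinv y));
  ibmeet_joinN : forall x y, ibmeet x (ibjoin (ibinv x) y) = ibmeet x y;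
  ibjoin0x : forall x, ibjoin ib0 x = x;
  ib1E : ib1 = ibinv ib0
}.

#[short(type="involutiveBisemilatticeType")]
HB.structure Definition InvolutiveBisemilattice :=
  {B of isInvolutiveBisemilattice B}.

Definition ibsymdiff (B : involutiveBisemilatticeType) (a b : B) : B :=
  ibjoin (ibmeet a (ibinv b)) (ibmeet (ibinv a) b).

Section PlonkaSum.
Local Open Scope order_scope.

(* The library's [{tblmorphism _ -> _}] only asks for the preservation of
   [\bot] and [\top]. *)
Definition boolean_morphism d1 d2 (A1 : ctbDistrLatticeType d1)
    (A2 : ctbDistrLatticeType d2) (f : A1 -> A2) : Prop :=
  [/\ {morph f : x y / x `&` y}, {morph f : x y / x `|` y},
      {morph f : x / ~` x}, f \bot = \bot & f \top = \top].

Record booleanSystem (d d' : Order.disp_t) := BooleanSystem {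
  bs_index : bJoinSemilatticeType d;
  bs_fiber : bs_index -> ctbDistrLatticeType d';
  bs_trans : forall i j : bs_index, i <= j -> bs_fiber i -> bs_fiber j;
  bs_trans_morphism : forall (i j : bs_index) (ij : i <= j),
    boolean_morphism (bs_trans ij);
  bs_trans_id : forall (i : bs_index) (ii : i <= i) (x : bs_fiber i), bs_trans ii x = x;
  bs_trans_comp : forall (i j k : bs_index) (ij : i <= j) (jk : j <= k)
    (ik : i <= k) (x : bs_fiber i), bs_trans ik x = bs_trans jk (bs_trans ij x)
}.

Context {d d' : Order.disp_t} (S : booleanSystem d d').

Definition plonkaSum : Type := {i : bs_index S & bs_fiber i}.
HB.instance Definition _ := Choice.on plonkaSum.

Implicit Types (a b c : plonkaSum) (i j k : bs_index S).

Definition inFiber i (x : bs_fiber i) : plonkaSum := existT _ i x.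

Definition lift_to k a (ak : tag a <= k) : bs_fiber k := bs_trans ak (tagged a).

Definition plonka_meet a b : plonkaSum :=
  inFiber (lift_to (leUl (tag a) (tag b)) `&` lift_to (leUr (tag b) (tag a))).
Definition plonka_join a b : plonkaSum :=
  inFiber (lift_to (leUl (tag a) (tag b)) `|` lift_to (leUr (tag b) (tag a))).
Definition plonka_inv a : plonkaSum := inFiber (~` tagged a).
Definition plonka_zero i : plonkaSum := inFiber (\bot : bs_fiber i).
Definition plonka_one i : plonkaSum := inFiber (\top : bs_fiber i).

Lemma eq_lift_to a b : tag a = tag b ->
  (forall k (ak : tag a <= k) (bk : tag b <= k), lift_to ak = lift_to bk) -> a = b.
Proof.
case: a b => [i x] [j y] /= ij; case: j / ij y => y /(_ i (lexx i) (lexx i)).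
by rewrite /lift_to /= !bs_trans_id => ->.
Qed.

Lemma lift_meet k a b (abk : tag (plonka_meet a b) <= k) (ak : tag a <= k)
  (bk : tag b <= k) : lift_to abk = lift_to ak `&` lift_to bk.
Proof.
rewrite /lift_to /=; have [-> _ _ _ _] := bs_trans_morphism abk.
by rewrite /lift_to -!bs_trans_comp.
Qed.

Lemma lift_join k a b (abk : tag (plonka_join a b) <= k) (ak : tag a <= k)
  (bk : tag b <= k) : lift_to abk = lift_to ak `|` lift_to bk.
Proof.
rewrite /lift_to /=; have [_ -> _ _ _] := bs_trans_morphism abk.
by rewrite /lift_to -!bs_trans_comp.
Qed.

Lemma lift_inv k a (ak' : tag (plonka_inv a) <= k) (ak : tag a <= k) :
  lift_to ak' = ~` lift_to ak.
Proof.
rewrite /lift_to /=; have [_ _ -> _ _] := bs_trans_morphism ak'.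
by congr (~` bs_trans _ _); exact: bool_irrelevance.
Qed.

Lemma lift_irr k a (ak ak' : tag a <= k) : lift_to ak = lift_to ak'.
Proof. by congr lift_to; exact: bool_irrelevance. Qed.

Lemma lift_zero k i (ik : tag (plonka_zero i) <= k) : lift_to ik = \bot.
Proof. by rewrite /lift_to /=; have [_ _ _ -> _] := bs_trans_morphism ik. Qed.

Lemma lift_trans k l a (ak : tag a <= k) (kl : k <= l) (al : tag a <= l) :
  lift_to al = bs_trans kl (lift_to ak).
Proof. by rewrite /lift_to -bs_trans_comp. Qed.

Fact plonka_joinxx a : plonka_join a a = a.
Proof.
apply: eq_lift_to => [|k aak ak] /=; first exact: joinxx.
by rewrite (lift_join _ ak ak) joinxx.
Qed.

Fact plonka_joinC a b : plonka_join a b = plonka_join b a.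
Proof.
apply: eq_lift_to => [|k abk bak] /=; first exact: joinC.
have := abk; rewrite leUx => /andP[ak bk].
by rewrite (lift_join abk ak bk) (lift_join bak bk ak) joinC.
Qed.

Fact plonka_joinA a b c :
  plonka_join a (plonka_join b c) = plonka_join (plonka_join a b) c.
Proof.
apply: eq_lift_to => [|k h1 h2] /=; first exact: joinA.
have := h1; rewrite !leUx => /and3P[ak bk ck].
have bck : tag (plonka_join b c) <= k by rewrite leUx bk.
have abk : tag (plonka_join a b) <= k by rewrite leUx ak.
rewrite (lift_join h1 ak bck) (lift_join h2 abk ck).
by rewrite (lift_join abk ak bk) (lift_join bck bk ck) joinA.
Qed.

Fact plonka_invK a : plonka_inv (plonka_inv a) = a.
Proof.
apply: eq_lift_to => [//|k ak ak'] /=.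
by rewrite (@lift_inv k (plonka_inv a) ak ak) (lift_inv _ ak') complK.
Qed.

Fact plonka_meetE a b :
  plonka_meet a b = plonka_inv (plonka_join (plonka_inv a) (plonka_inv b)).
Proof.
apply: eq_lift_to => [//|k h1 h2] /=.
have := h1; rewrite leUx => /andP[ak bk].
rewrite (lift_meet h1 ak bk).
rewrite (@lift_inv k (plonka_join (plonka_inv a) (plonka_inv b)) h2 h2).
rewrite (@lift_join k (plonka_inv a) (plonka_inv b) h2 ak bk).
by rewrite (lift_inv _ ak) (lift_inv _ bk) complU !complK.
Qed.

Fact plonka_meet_joinN a b :
  plonka_meet a (plonka_join (plonka_inv a) b) = plonka_meet a b.
Proof.
apply: eq_lift_to => [|k h1 h2] /=; first by rewrite joinA joinxx.
have := h2; rewrite leUx => /andP[ak bk].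
rewrite (lift_meet h2 ak bk) (lift_meet h1 ak h2).
rewrite (@lift_join k (plonka_inv a) b h2 ak bk) (lift_inv _ ak).
by rewrite meetUr meetxC join0x.
Qed.

Fact plonka_join0x a : plonka_join (plonka_zero \bot) a = a.
Proof.
apply: eq_lift_to => [|k h1 ak] /=; first exact: join0x.
by rewrite (@lift_join k _ a h1 (le0x _) ak) lift_zero join0x.
Qed.

Fact plonka_1E : plonka_one \bot = plonka_inv (plonka_zero \bot).
Proof. by rewrite /plonka_one /plonka_inv /= compl0. Qed.

HB.instance Definition _ := isInvolutiveBisemilattice.Build plonkaSum
  plonka_joinxx plonka_joinC plonka_joinA plonka_invK plonka_meetE
  plonka_meet_joinN plonka_join0x plonka_1E.

Definition sim a b : Prop :=
  exists k (ak : tag a <= k) (bk : tag b <= k), lift_to ak = lift_to bk.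

Fact sim_equiv : equiv_class_of (fun a b => `[< sim a b >]).
Proof.
split=> [a|a b|b a c].
- by apply/asboolP; exists (tag a), (lexx _), (lexx _).
- by apply/asbool_equiv_eq; split=> -[k [ak [bk e]]]; exists k, bk, ak.
- move=> /asboolP[k [ak [bk e]]] /asboolP[l [bl [cl f]]]; apply/asboolP.
  have [kkl lkl] := (leUl k l, leUr l k).
  exists (k `|` l), (le_trans ak kkl), (le_trans cl lkl).
  rewrite (lift_trans ak kkl) (lift_trans cl lkl) e -f.
  rewrite -(lift_trans bk kkl (le_trans bk kkl)).
  by rewrite -(lift_trans bl lkl (le_trans bk kkl)).
Qed.

Canonical sim_equiv_rel := EquivRelPack sim_equiv.

Definition booleanisation : Type := {eq_quot sim_equiv_rel}%qT.
HB.instance Definition _ := Choice.on booleanisation.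
HB.instance Definition _ := EqQuotient.on booleanisation.

Definition bproj (a : plonkaSum) : booleanisation :=
  (\pi_({eq_quot sim_equiv_rel}) a)%qT.

Lemma bproj_eq a b : bproj a = bproj b <-> sim a b.
Proof. by split=> [/eqmodP/asboolP //|h]; apply/eqmodP/asboolP. Qed.


Lemma bproj_repr (x : booleanisation) : bproj (repr x) = x.
Proof. exact: reprK. Qed.

Lemma bproj_lift k a (ak : tag a <= k) : bproj a = bproj (inFiber (lift_to ak)).
Proof.
apply/bproj_eq; exists k, ak, (lexx k).
by rewrite {2}/lift_to /= bs_trans_id.
Qed.

Lemma bproj_common (x y z : booleanisation) : exists k (u v w : bs_fiber k),
  [/\ x = bproj (inFiber u), y = bproj (inFiber v) & z = bproj (inFiber w)].
Proof.
have [xk yk zk] : [/\ tag (repr x) <= tag (repr x) `|` tag (repr y) `|` tag (repr z),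
    tag (repr y) <= tag (repr x) `|` tag (repr y) `|` tag (repr z) &
    tag (repr z) <= tag (repr x) `|` tag (repr y) `|` tag (repr z)].
  by rewrite leUr -joinA leUl joinCA leUl.
exists _, (lift_to xk), (lift_to yk), (lift_to zk).
by rewrite -!bproj_lift !bproj_repr.
Qed.

(* These do not depend on the representatives, see [bproj_meet], [bproj_join]
   and [bproj_inv]. *)
Definition bool_meet (x y : booleanisation) := bproj (plonka_meet (repr x) (repr y)).
Definition bool_join (x y : booleanisation) := bproj (plonka_join (repr x) (repr y)).
Definition bool_compl (x : booleanisation) := bproj (plonka_inv (repr x)).
Definition bool_bot : booleanisation := bproj (plonka_zero \bot).
Definition bool_top : booleanisation := bproj (plonka_one \bot).

Lemma sim_common a a' b b' : sim a a' -> sim b b' ->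
  exists k (ak : tag a <= k) (ak' : tag a' <= k) (bk : tag b <= k)
    (bk' : tag b' <= k), lift_to ak = lift_to ak' /\ lift_to bk = lift_to bk'.
Proof.
move=> [k [ak [ak' e]]] [l [bl [bl' f]]].
have [kkl lkl] := (leUl k l, leUr l k).
exists (k `|` l), (le_trans ak kkl), (le_trans ak' kkl), (le_trans bl lkl),
  (le_trans bl' lkl).
rewrite (lift_trans ak kkl) (lift_trans ak' kkl) e; split=> //.
by rewrite (lift_trans bl lkl) (lift_trans bl' lkl) f.
Qed.

Lemma bproj_meet a b : bproj (plonka_meet a b) = bool_meet (bproj a) (bproj b).
Proof.
have [ha hb] : sim a (repr (bproj a)) /\ sim b (repr (bproj b)).
  by split; apply/bproj_eq; rewrite bproj_repr.
have [k [ak [ak' [bk [bk' [e f]]]]]] := sim_common ha hb.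
apply/bproj_eq.
have hk : tag (plonka_meet a b) <= k by rewrite leUx ak.
have hk' : tag (plonka_meet (repr (bproj a)) (repr (bproj b))) <= k.
  by rewrite leUx ak'.
by exists k, hk, hk'; rewrite (lift_meet hk ak bk) (lift_meet hk' ak' bk') e f.
Qed.

Lemma bproj_join a b : bproj (plonka_join a b) = bool_join (bproj a) (bproj b).
Proof.
have [ha hb] : sim a (repr (bproj a)) /\ sim b (repr (bproj b)).
  by split; apply/bproj_eq; rewrite bproj_repr.
have [k [ak [ak' [bk [bk' [e f]]]]]] := sim_common ha hb.
apply/bproj_eq.
have hk : tag (plonka_join a b) <= k by rewrite leUx ak.
have hk' : tag (plonka_join (repr (bproj a)) (repr (bproj b))) <= k.
  by rewrite leUx ak'.
by exists k, hk, hk'; rewrite (lift_join hk ak bk) (lift_join hk' ak' bk') e f.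
Qed.

Lemma bproj_inv a : bproj (plonka_inv a) = bool_compl (bproj a).
Proof.
have /bproj_eq[k [ak [ak' e]]] := bproj_repr (bproj a).
apply/bproj_eq; exists k, ak', ak.
by rewrite (lift_inv _ ak') (lift_inv _ ak) e.
Qed.

Lemma bproj_zero i : bproj (plonka_zero i) = bool_bot.
Proof. by apply/bproj_eq; exists i, (lexx i), (le0x i); rewrite !lift_zero. Qed.

Lemma bproj_one i : bproj (plonka_one i) = bool_top.
Proof.
have oneE j : plonka_one j = plonka_inv (plonka_zero j).
  by rewrite /plonka_one /plonka_inv /= compl0.
by rewrite /bool_top !oneE !bproj_inv !bproj_zero.
Qed.

Lemma bool_meetE k (u v : bs_fiber k) :
  bool_meet (bproj (inFiber u)) (bproj (inFiber v)) = bproj (inFiber (u `&` v)).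
Proof.
have h : tag (plonka_meet (inFiber u) (inFiber v)) <= k by rewrite leUx !lexx.
rewrite -bproj_meet (bproj_lift h).
rewrite (@lift_meet k (inFiber u) (inFiber v) h (lexx k) (lexx k)).
by rewrite /lift_to /= !bs_trans_id.
Qed.

Lemma bool_joinE k (u v : bs_fiber k) :
  bool_join (bproj (inFiber u)) (bproj (inFiber v)) = bproj (inFiber (u `|` v)).
Proof.
have h : tag (plonka_join (inFiber u) (inFiber v)) <= k by rewrite leUx !lexx.
rewrite -bproj_join (bproj_lift h).
rewrite (@lift_join k (inFiber u) (inFiber v) h (lexx k) (lexx k)).
by rewrite /lift_to /= !bs_trans_id.
Qed.

Lemma bool_complE k (u : bs_fiber k) :
  bool_compl (bproj (inFiber u)) = bproj (inFiber (~` u)).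
Proof. by rewrite -bproj_inv. Qed.

Definition bool_le x y := bool_meet x y == x.
Definition bool_lt x y := (y != x) && bool_le x y.

Fact bool_meetC : commutative bool_meet.
Proof.
by move=> x y; have [k [u [v [_ [-> -> _]]]]] := bproj_common x y x;
  rewrite !bool_meetE meetC.
Qed.
Fact bool_joinC : commutative bool_join.
Proof.
by move=> x y; have [k [u [v [_ [-> -> _]]]]] := bproj_common x y x;
  rewrite !bool_joinE joinC.
Qed.
Fact bool_meetA : associative bool_meet.
Proof.
by move=> x y z; have [k [u [v [w [-> -> ->]]]]] := bproj_common x y z;
  rewrite !bool_meetE meetA.
Qed.
Fact bool_joinA : associative bool_join.
Proof.
by move=> x y z; have [k [u [v [w [-> -> ->]]]]] := bproj_common x y z;
  rewrite !bool_joinE joinA.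
Qed.
Fact bool_joinKI y x : bool_meet x (bool_join x y) = x.
Proof.
by have [k [u [v [_ [-> -> _]]]]] := bproj_common x y x;
  rewrite bool_joinE bool_meetE joinKI.
Qed.
Fact bool_meetKU y x : bool_join x (bool_meet x y) = x.
Proof.
by have [k [u [v [_ [-> -> _]]]]] := bproj_common x y x;
  rewrite bool_meetE bool_joinE meetKU.
Qed.
Fact bool_meetUl : left_distributive bool_meet bool_join.
Proof.
by move=> x y z; have [k [u [v [w [-> -> ->]]]]] := bproj_common x y z;
  rewrite !(bool_meetE, bool_joinE) meetUl.
Qed.
Fact bool_meetxx : idempotent_op bool_meet.
Proof.
by move=> x; have [k [u [_ [_ [-> _ _]]]]] := bproj_common x x x;
  rewrite bool_meetE meetxx.
Qed.

HB.instance Definition _ := Order.isMeetJoinDistrLattice.Build d' booleanisation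
  (fun _ _ => erefl) (fun _ _ => erefl) bool_meetC bool_joinC bool_meetA
  bool_joinA bool_joinKI bool_meetKU bool_meetUl bool_meetxx.

Fact bool_le0x (x : booleanisation) : bool_bot <= x.
Proof.
apply/eqP; have [k [u [_ [_ [-> _ _]]]]] := bproj_common x x x.
by rewrite -(bproj_zero k) bool_meetE meet0x.
Qed.
Fact bool_lex1 (x : booleanisation) : x <= bool_top.
Proof.
apply/eqP; have [k [u [_ [_ [-> _ _]]]]] := bproj_common x x x.
by rewrite -(bproj_one k) bool_meetE meetx1.
Qed.

HB.instance Definition _ := Order.hasBottom.Build d' booleanisation bool_le0x.
HB.instance Definition _ := Order.hasTop.Build d' booleanisation bool_lex1.

Fact bool_joinxC (x : booleanisation) : x `|` bool_compl x = \top.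
Proof.
have [k [u [_ [_ [-> _ _]]]]] := bproj_common x x x.
by rewrite bool_complE [LHS]bool_joinE joinxC bproj_one.
Qed.
Fact bool_meetxC (x : booleanisation) : x `&` bool_compl x = \bot.
Proof.
have [k [u [_ [_ [-> _ _]]]]] := bproj_common x x x.
by rewrite bool_complE [LHS]bool_meetE meetxC bproj_zero.
Qed.

HB.instance Definition _ := Order.TBDistrLattice_hasComplement.Build d' booleanisation
  bool_joinxC bool_meetxC.

End PlonkaSum.

Section SymmetricDifference.
Local Open Scope order_scope.
Context {d : Order.disp_t} {A : ctbDistrLatticeType d}.
Implicit Types x y z : A.

Definition symdiff x y : A := (x `&` ~` y) `|` (~` x `&` y).

Lemma symdiffxx x : symdiff x x = \bot.
Proof. by rewrite /symdiff meetxC meetCx joinx0. Qed.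

Lemma symdiffC x y : symdiff x y = symdiff y x.
Proof. by rewrite /symdiff joinC meetC [~` y `&` x]meetC. Qed.

Lemma symdiff_triangle y x z : symdiff x z <= symdiff x y `|` symdiff y z.
Proof.
have sub (u v w : A) : u `&` ~` w <= (u `&` ~` v) `|` (v `&` ~` w).
  rewrite -[leLHS]meetx1 -(joinxC v) meetUr joinC leU2 //.
    by rewrite meetAC leIl.
  by rewrite meetC leI2 // leIr.
rewrite /symdiff leUx; apply/andP; split.
  by apply: (le_trans (sub x y z)); rewrite leU2 // leUl.
rewrite [~` x `&` z]meetC [~` x `&` y]meetC [~` y `&` z]meetC.
by apply: (le_trans (sub z y x)); rewrite joinC leU2 // leUr.
Qed.

End SymmetricDifference.

Definition ib_isomorphism (B C : involutiveBisemilatticeType) (f : B -> C) :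
    Prop :=
  [/\ bijective f, {morph f : x y / ibmeet x y}, {morph f : x y / ibjoin x y},
      {morph f : x / ibinv x} & f ib0 = ib0 /\ f ib1 = ib1].

Section PlonkaRepresentation.
Local Open Scope order_scope.
Context (B : involutiveBisemilatticeType).
Implicit Types x y a b : B.

Local Notation "x ||| y" := (ibjoin x y) (at level 50, left associativity).
Local Notation "x &&& y" := (ibmeet x y) (at level 40, left associativity).
Local Notation "~~~ x" := (ibinv x) (at level 35, right associativity).

Let z a := a &&& ~~~ a.
Let e a := a ||| ~~~ a.

Let joinCA x y w : x ||| (y ||| w) = y ||| (x ||| w).
Proof. by rewrite !ibjoinA (ibjoinC x). Qed.
Let invU x y : ~~~ (x ||| y) = ~~~ x &&& ~~~ y.
Proof. by rewrite ibmeetE !ibinvK. Qed.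
Let invI x y : ~~~ (x &&& y) = ~~~ x ||| ~~~ y.
Proof. by rewrite ibmeetE ibinvK. Qed.
Let meetC x y : x &&& y = y &&& x.
Proof. by rewrite !ibmeetE ibjoinC. Qed.
Let meetA x y w : x &&& (y &&& w) = x &&& y &&& w.
Proof. by rewrite !ibmeetE !ibinvK ibjoinA. Qed.
Let meetxx x : x &&& x = x.
Proof. by rewrite ibmeetE ibjoinxx ibinvK. Qed.
Let joinNI x y : x ||| (~~~ x &&& y) = x ||| y.
Proof.
by apply: (can_inj (@ibinvK B)); rewrite !invU !invI ibmeet_joinN.
Qed.
Let zE a : z a = ~~~ e a.
Proof. by rewrite /z /e invU ibinvK meetC. Qed.
Let eN a : e (~~~ a) = e a.
Proof. by rewrite /e ibinvK ibjoinC. Qed.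
Let zN a : z (~~~ a) = z a.
Proof. by rewrite !zE eN. Qed.
Let eUr a b : e (a ||| b) = a ||| e b.
Proof.
rewrite {1}/e invU [a ||| b]ibjoinC -ibjoinA joinNI /e.
by rewrite joinCA.
Qed.
Let eUl a b : e (a ||| b) = e a ||| b.
Proof. by rewrite ibjoinC eUr ibjoinC. Qed.
Let ee a : e (e a) = e a.
Proof.
have -> : e (e a) = e a ||| (a &&& ~~~ a) by rewrite {1}/e /e invU ibinvK meetC.
rewrite /e -ibjoinA; congr ibjoin.
by have := joinNI (~~~ a) (~~~ a); rewrite ibinvK ibjoinxx meetC => ->.
Qed.
Let eU a b : e (a ||| b) = e a ||| e b.
Proof. by rewrite -[LHS]ee eUr eUl. Qed.
Let e_meet a b : e a &&& e b = e a ||| e b.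
Proof.
set p := e a; set q := e b; set r := p ||| q.
have [ep eq] : e p = p /\ e q = q by rewrite /p /q !ee.
have er : ~~~ p ||| q = r by rewrite -{1}eq -eUr eUl eN ep.
have pq : p &&& q = p &&& r by rewrite -er ibmeet_joinN.
have wp : ~~~ r ||| p = r.
  by rewrite invU ibjoinC joinNI -ep -eUl eU eN ep eq.
by rewrite pq meetC -ibmeet_joinN wp meetxx.
Qed.
Let zU a b : z (a ||| b) = z a ||| z b.
Proof. by rewrite !zE eU -e_meet invI. Qed.
Let zI a b : z (a &&& b) = z a ||| z b.
Proof. by rewrite ibmeetE zN zU !zN. Qed.
Let zz a : z (z a) = z a.
Proof. by rewrite zE -[e (z a)]eN zE ibinvK ee. Qed.
Let xUz a : a ||| z a = a.
Proof. by rewrite /z meetC joinNI ibjoinxx. Qed.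
Let xIe a : a &&& e a = a.
Proof. by rewrite /e ibjoinC ibmeet_joinN meetxx. Qed.
Let joinKI a b : z a = z b -> a &&& (a ||| b) = a.
Proof.
move=> ab; rewrite -ibmeet_joinN ibjoinA [_ ||| a]ibjoinC.
rewrite -[_ ||| b]/(e a ||| b) -eUl eU.
have <- : e a = e b by rewrite -[e a]ibinvK -[e b]ibinvK -!zE ab.
by rewrite ibjoinxx xIe.
Qed.
Let meetKU a b : z a = z b -> a ||| (a &&& b) = a.
Proof.
move=> ab; apply: (can_inj (@ibinvK B)).
by rewrite invU invI joinKI // !zN.
Qed.

Let le a b := a &&& b = a.
Let le_trans a b c : le a b -> le b c -> le a c.
Proof. by rewrite /le => ab bc; rewrite -ab -meetA bc. Qed.
Let leU a b : z a = z b -> le a b <-> a ||| b = b.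
Proof.
move=> ab; split=> h; last by rewrite /le -h joinKI.
by rewrite -h ibjoinC meetC meetKU.
Qed.
Let leI2 a b c : le b c -> le (a &&& b) (a &&& c).
Proof.
rewrite /le => bc.
by rewrite meetA -(meetA a b a) (meetC b a) (meetA a a b) meetxx -meetA bc.
Qed.
Let lexU a b : z a = z b -> le a (a ||| b).
Proof. exact: joinKI. Qed.
Let residual a b c : z a = z b -> z b = z c -> le (a &&& b) c ->
  le a (~~~ b ||| c).
Proof.
move=> ab bc h.
have zabc : z (a &&& b) = z c by rewrite zI ab bc ibjoinxx.
have h2 : ~~~ b ||| (b &&& a) = ~~~ b ||| a.
  by have := joinNI (~~~ b) a; rewrite ibinvK.
have hc : (a &&& b) ||| c = c by exact/leU.
rewrite -hc ibjoinA (meetC a b) h2 (ibjoinC _ a) -ibjoinA; apply: lexU.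
by rewrite zU zN ab bc ibjoinxx.
Qed.
Let meetUl a b c : z a = z b -> z b = z c ->
  (a ||| b) &&& c = (a &&& c) ||| (b &&& c).
Proof.
move=> ab bc; set w := _ ||| (b &&& c).
have zw : z w = z c by rewrite /w zU !zI ab bc !ibjoinxx.
have zcw : z (~~~ c ||| w) = z c by rewrite zU zN zw ibjoinxx.
have [zac zbc] : z (a &&& c) = z c /\ z (b &&& c) = z c.
  by rewrite !zI ab bc !ibjoinxx.
have aw : le a (~~~ c ||| w).
  by apply: residual; rewrite ?ab ?zw // /w; apply: lexU; rewrite zac zbc.
have bw : le b (~~~ c ||| w).
  apply: residual; rewrite ?zw // /w ibjoinC; apply: lexU.
  by rewrite zac zbc.
have abw : le (a ||| b) (~~~ c ||| w).
  have zabw : z (a ||| b) = z (~~~ c ||| w) by rewrite zU ab bc ibjoinxx zcw.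
  have h1 : a ||| (~~~ c ||| w) = ~~~ c ||| w by apply/leU; rewrite ?zcw ?ab.
  have h2 : b ||| (~~~ c ||| w) = ~~~ c ||| w by apply/leU; rewrite ?zcw.
  by apply/leU; rewrite // -ibjoinA h2 h1.
have lw : le ((a ||| b) &&& c) w.
  rewrite meetC; apply: le_trans (leI2 c abw) _.
  by rewrite ibmeet_joinN /le -meetA meetxx.
have wl : le w ((a ||| b) &&& c).
  have zabc : z ((a ||| b) &&& c) = z c by rewrite zI zU ab bc !ibjoinxx.
  have h1 : le (a &&& c) ((a ||| b) &&& c).
    by rewrite !(meetC _ c); apply: leI2; apply: lexU.
  have h2 : le (b &&& c) ((a ||| b) &&& c).
    by rewrite !(meetC _ c); apply: leI2; rewrite ibjoinC; apply: lexU.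
  apply/leU; first by rewrite zw zabc.
  have {}h1 : a &&& c ||| (a ||| b) &&& c = (a ||| b) &&& c.
    by apply/leU; rewrite ?zac ?zabc.
  have {}h2 : b &&& c ||| (a ||| b) &&& c = (a ||| b) &&& c.
    by apply/leU; rewrite ?zbc ?zabc.
  by rewrite /w -ibjoinA h2 h1.
by rewrite -lw meetC.
Qed.

Let join_zero_inv a j : z j = j -> z a ||| j = j ->
  ~~~ a ||| j = ~~~ (a ||| j).
Proof.
move=> zj aj; rewrite invU; move: (~~~ a) (zN a) => b zb.
rewrite -zb in aj; clear zb.
have ej : e j = ~~~ j by rewrite -{2}zj zE ibinvK.
have ebej : e b ||| ~~~ j = ~~~ j.
  by rewrite -{2}aj -{2}zj -zU zE ibinvK eU ej.
have ebj : e b ||| j = ~~~ j by rewrite -eUl eU ej.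
have bj : b ||| ~~~ j = ~~~ j by rewrite -ej -eUr eU ej.
set c := b ||| j; set d' := b &&& ~~~ j.
have bc : b &&& c = d'.
  by rewrite -ibmeet_joinN ibjoinA (ibjoinC _ b) [_ ||| j]ebj.
have ec : e c = ~~~ j by rewrite /c eUl ebj.
have cd0 : c &&& ~~~ d' = j.
  rewrite -bc invI ibjoinC ibmeet_joinN meetC /c.
  have := ibmeet_joinN (~~~ b) j; rewrite ibinvK => ->.
  by rewrite ibmeetE ibinvK bj ibinvK.
have cd : c &&& d' = c.
  rewrite -ibmeet_joinN -[_ ||| d']ibinvK invU ibinvK.
  by rewrite cd0 -ec xIe.
have dc : d' &&& c = d'.
  by rewrite /d' -meetA (meetC _ c) meetA bc /d' -meetA meetxx.
by rewrite -cd meetC dc.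
Qed.

Let sig_inj (P : B -> Prop) (u v : {x | P x}) : proj1_sig u = proj1_sig v -> u = v.
Proof. by case: u v => ? ? [? ?]; exact: eq_exist. Qed.

Definition ib_index : Type := {i : B | z i = i}.
HB.instance Definition _ := gen_eqMixin ib_index.
HB.instance Definition _ := gen_choiceMixin ib_index.

Let ix (i : ib_index) : B := proj1_sig i.
Let ix_inj (i j : ib_index) : ix i = ix j -> i = j.
Proof. exact: sig_inj. Qed.

Definition ib_index_le (i j : ib_index) := `[< ix i ||| ix j = ix j >].
Fact ib_index_le_refl : reflexive ib_index_le.
Proof. by move=> i; apply/asboolP; exact: ibjoinxx. Qed.
Fact ib_index_le_anti : antisymmetric ib_index_le.
Proof.
move=> i j /andP[/asboolP ij /asboolP ji].
by apply: ix_inj; rewrite -ij ibjoinC ji.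
Qed.
Fact ib_index_le_trans : transitive ib_index_le.
Proof.
move=> j i k /asboolP ij /asboolP jk; apply/asboolP.
by rewrite -jk ibjoinA ij.
Qed.
HB.instance Definition _ := Order.Le_isPOrder.Build (Order.Disp tt tt) ib_index
  ib_index_le_refl ib_index_le_anti ib_index_le_trans.

Fact ib_index_join_subproof (i j : ib_index) : z (ix i ||| ix j) = ix i ||| ix j.
Proof. by rewrite zU (proj2_sig i) (proj2_sig j). Qed.
Definition ib_index_join (i j : ib_index) : ib_index :=
  exist _ _ (ib_index_join_subproof i j).
Fact ib_index_joinC : commutative ib_index_join.
Proof. by move=> i j; apply: ix_inj; exact: ibjoinC. Qed.
Fact ib_index_joinA : associative ib_index_join.
Proof. by move=> i j k; apply: ix_inj; exact: ibjoinA. Qed.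
Fact ib_index_leEjoin (i j : ib_index) : (j <= i) = (ib_index_join i j == i).
Proof.
apply/asboolP/eqP => [h|/(congr1 ix) h].
  by apply: ix_inj; rewrite -[RHS]h; exact: ibjoinC.
by rewrite -[RHS]h; exact: ibjoinC.
Qed.
HB.instance Definition _ := Order.POrder_Join_isSemilattice.Build
  (Order.Disp tt tt) ib_index ib_index_joinC ib_index_joinA ib_index_leEjoin.

Fact ib_index_bot_subproof : z (ib0 : B) = ib0.
Proof. by rewrite zE /e ibjoin0x ibinvK. Qed.
Definition ib_index_bot : ib_index := exist _ _ ib_index_bot_subproof.
Fact ib_index_le0x (i : ib_index) : ib_index_bot <= i.
Proof. by apply/asboolP; exact: ibjoin0x. Qed.
HB.instance Definition _ := Order.hasBottom.Build (Order.Disp tt tt) ib_index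
  ib_index_le0x.

Section Fiber.
Variable i : ib_index.

Definition ib_fiber : Type := {a : B | z a = ix i}.
HB.instance Definition _ := gen_eqMixin ib_fiber.
HB.instance Definition _ := gen_choiceMixin ib_fiber.

Let fb (u : ib_fiber) : B := proj1_sig u.
Let fb_inj u v : fb u = fb v -> u = v.
Proof. exact: sig_inj. Qed.
Let zf u v : z (fb u) = z (fb v).
Proof. by rewrite (proj2_sig u) (proj2_sig v). Qed.

Fact ib_fiber_meet_subproof u v : z (fb u &&& fb v) = ix i.
Proof. by rewrite zI (proj2_sig u) (proj2_sig v) ibjoinxx. Qed.
Definition ib_fiber_meet u v : ib_fiber := exist _ _ (ib_fiber_meet_subproof u v).
Fact ib_fiber_join_subproof u v : z (fb u ||| fb v) = ix i.
Proof. by rewrite zU (proj2_sig u) (proj2_sig v) ibjoinxx. Qed.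
Definition ib_fiber_join u v : ib_fiber := exist _ _ (ib_fiber_join_subproof u v).
Fact ib_fiber_compl_subproof u : z (~~~ fb u) = ix i.
Proof. by rewrite zN (proj2_sig u). Qed.
Definition ib_fiber_compl u : ib_fiber := exist _ _ (ib_fiber_compl_subproof u).
Definition ib_fiber_bot : ib_fiber :=
  exist (fun a => z a = ix i) (ix i) (proj2_sig i).
Definition ib_fiber_top : ib_fiber := ib_fiber_compl ib_fiber_bot.

Fact ib_fiber_meetC : commutative ib_fiber_meet.
Proof. by move=> u v; apply: fb_inj; exact: meetC. Qed.
Fact ib_fiber_joinC : commutative ib_fiber_join.
Proof. by move=> u v; apply: fb_inj; exact: ibjoinC. Qed.
Fact ib_fiber_meetA : associative ib_fiber_meet.
Proof. by move=> u v w; apply: fb_inj; exact: meetA. Qed.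
Fact ib_fiber_joinA : associative ib_fiber_join.
Proof. by move=> u v w; apply: fb_inj; exact: ibjoinA. Qed.
Fact ib_fiber_joinKI v u : ib_fiber_meet u (ib_fiber_join u v) = u.
Proof. by apply: fb_inj; apply: joinKI; exact: zf. Qed.
Fact ib_fiber_meetKU v u : ib_fiber_join u (ib_fiber_meet u v) = u.
Proof. by apply: fb_inj; apply: meetKU; exact: zf. Qed.
Fact ib_fiber_meetUl : left_distributive ib_fiber_meet ib_fiber_join.
Proof. by move=> u v w; apply: fb_inj; apply: meetUl; exact: zf. Qed.
Fact ib_fiber_meetxx : idempotent_op ib_fiber_meet.
Proof. by move=> u; apply: fb_inj; exact: meetxx. Qed.

HB.instance Definition _ := Order.isMeetJoinDistrLattice.Build
  (Order.Disp tt tt) ib_fiber (fun _ _ => erefl) (fun _ _ => erefl)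
  ib_fiber_meetC ib_fiber_joinC ib_fiber_meetA ib_fiber_joinA ib_fiber_joinKI
  ib_fiber_meetKU ib_fiber_meetUl ib_fiber_meetxx.

Fact ib_fiber_joinxC (u : ib_fiber) : u `|` ib_fiber_compl u = ib_fiber_top.
Proof.
apply: fb_inj; rewrite -[LHS]/(e (fb u)) -[LHS]ibinvK -zE.
by rewrite (proj2_sig u).
Qed.
Fact ib_fiber_meetxC (u : ib_fiber) : u `&` ib_fiber_compl u = ib_fiber_bot.
Proof. by apply: fb_inj; exact: (proj2_sig u). Qed.
Fact ib_fiber_le0x (u : ib_fiber) : ib_fiber_bot <= u.
Proof. by rewrite -(ib_fiber_meetxC u) leIl. Qed.
Fact ib_fiber_lex1 (u : ib_fiber) : u <= ib_fiber_top.
Proof. by rewrite -(ib_fiber_joinxC u) leUl. Qed.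

HB.instance Definition _ := Order.hasBottom.Build (Order.Disp tt tt) ib_fiber
  ib_fiber_le0x.
HB.instance Definition _ := Order.hasTop.Build (Order.Disp tt tt) ib_fiber
  ib_fiber_lex1.
HB.instance Definition _ := Order.TBDistrLattice_hasComplement.Build
  (Order.Disp tt tt) ib_fiber ib_fiber_joinxC ib_fiber_meetxC.

End Fiber.

Fact ib_trans_subproof (i j : ib_index) (ij : i <= j) (u : ib_fiber i) :
  z (proj1_sig u ||| ix j) = ix j.
Proof. by rewrite zU (proj2_sig u) (proj2_sig j); exact/asboolP. Qed.
Definition ib_trans (i j : ib_index) (ij : i <= j) (u : ib_fiber i) :
  ib_fiber j := exist _ _ (ib_trans_subproof ij u).

Fact ib_trans_morphism (i j : ib_index) (ij : i <= j) :
  boolean_morphism (ib_trans ij).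
Proof.
have U : {morph ib_trans ij : u v / u `|` v}.
  move=> u v; apply: sig_inj.
  case: u v => [a za] [b zb]; change (a ||| b ||| ix j = a ||| ix j ||| (b ||| ix j)).
  by rewrite -!ibjoinA (joinCA (ix j)) ibjoinxx.
have N : {morph ib_trans ij : u / ~` u}.
  move=> u; apply: sig_inj => /=; apply: join_zero_inv.
    exact: (proj2_sig j).
  by rewrite (proj2_sig u); exact/asboolP.
have Z : ib_trans ij \bot = \bot by apply: sig_inj; exact/asboolP.
split=> // [u v|].
  by apply: compl_inj; rewrite -N !complI U !N.
by rewrite -[\top in LHS]compl0 N Z compl0.
Qed.

Fact ib_trans_id (i : ib_index) (ii : i <= i) (u : ib_fiber i) :
  ib_trans ii u = u.
Proof.
by apply: sig_inj; case: u => a za; change (a ||| ix i = a); rewrite -za xUz.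
Qed.

Fact ib_trans_comp (i j k : ib_index) (ij : i <= j) (jk : j <= k) (ik : i <= k)
  (u : ib_fiber i) : ib_trans ik u = ib_trans jk (ib_trans ij u).
Proof. by apply: sig_inj; rewrite /= -ibjoinA; move/asboolP: jk => ->. Qed.

Definition ib_system : booleanSystem (Order.Disp tt tt) (Order.Disp tt tt) :=
  BooleanSystem ib_trans_morphism ib_trans_id ib_trans_comp.

(* Every involutive bisemilattice is isomorphic to the Plonka sum of its
   canonical system: the indices are the elements [a /\ a'], the fiber over [i]
   is [{a | a /\ a' = i}], and the transition maps are [a |-> a \/ j]. *)
Definition to_plonka a : plonkaSum ib_system :=
  @inFiber _ _ ib_system (exist _ _ (zz a)) (exist _ a erefl).

Theorem to_plonka_isomorphism : ib_isomorphism to_plonka.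
Proof.
pose from (u : plonkaSum ib_system) : B := proj1_sig (tagged u).
have toK : cancel to_plonka from by [].
have fromK : cancel from to_plonka.
  move=> [[i zi] [a ai]]; rewrite /from /to_plonka /=.
  move: ai; rewrite /ix /= => ai; case: i / ai zi => zi.
  by rewrite (Prop_irrelevance zi (zz a)).
have from_inj := can_inj fromK.
have U : {morph to_plonka : x y / ibjoin x y}.
  move=> x y; apply: from_inj; rewrite toK /from /=.
  by rewrite -ibjoinA [_ ||| (y ||| _)]joinCA ibjoinxx ibjoinA -zU xUz.
have N : {morph to_plonka : x / ibinv x}.
  by move=> x; apply: from_inj; rewrite toK.
have Z : to_plonka ib0 = ib0 by apply: from_inj; rewrite toK.
split=> //; first by exists from.
  by move=> x y; rewrite !ibmeetE N U !N.
by rewrite !ib1E N Z.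
Qed.

End PlonkaRepresentation.

HB.factory Record hasPseudodistance (R : numFieldType) (M : Type) & Choice M := {
  pdist : M -> M -> R;
  pdistxx : forall x, pdist x x = 0%R;
  pdist_sym : forall x y, pdist x y = pdist y x;
  pdist_triangle : forall y x z, (pdist x z <= pdist x y + pdist y z)%R
}.

HB.builders Context R M & hasPseudodistance R M.

Let ball (x : M) e : set M := [set y | (pdist x y < e)%R]%classic.

Let ent : set_system (M * M) := entourage_ ball.

Let nbhs (x : M) : set_system M := nbhs_ ent x.

Let nbhsE : nbhs = nbhs_ ent. Proof. by []. Qed.

HB.instance Definition _ := hasNbhs.Build M nbhs.

Let ball_center x (e : R) : (0 < e)%R -> ball x e x.
Proof. by move=> e0; rewrite /ball /= pdistxx. Qed.

Let ball_sym x y (e : R) : ball x e y -> ball y e x.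
Proof. by rewrite /ball /= pdist_sym. Qed.

Let ball_triangle x y z e1 e2 : ball x e1 y -> ball y e2 z ->
  ball x (e1 + e2)%R z.
Proof.
by rewrite /ball /= => ? ?; rewrite (le_lt_trans (pdist_triangle y _ _)) // ltrD.
Qed.

Let entourageE : ent = entourage_ ball. Proof. by []. Qed.

HB.instance Definition _ := @Nbhs_isPseudoMetric.Build R M
  ent nbhsE ball ball_center ball_sym ball_triangle entourageE.

HB.end.

Section States.
Local Open Scope ring_scope.
Context {d d' : Order.disp_t} {S : booleanSystem d d'} {R : realType}.

Definition is_zero (a : plonkaSum S) : Prop := exists i, a = plonka_zero i.

Record state := State {
  state_fun :> plonkaSum S -> R;
  state_itv : forall a, 0 <= state_fun a <= 1;
  state1 : state_fun ib1 = 1;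
  stateD : forall a b, is_zero (ibmeet a b) ->
    state_fun (ibjoin a b) = state_fun a + state_fun b
}.

Definition faithful (s : state) : Prop := forall a, ~ is_zero a -> 0 < s a.

Variable s : state.
Implicit Types (a b : plonkaSum S) (x y : booleanisation S).

(* Independent of the representative, see [PhiE]. *)
Definition Phi x : R := s (repr x).

Definition state_dist a b : R := s (ibsymdiff a b).

Definition bool_dist x y : R := Phi (symdiff x y).

Lemma state_zero i : s (plonka_zero i) = 0.
Proof.
have zz : ibmeet (plonka_zero i) (plonka_zero i) = plonka_zero i.
  by rewrite ibmeetE ibjoinxx ibinvK.
have h : is_zero (ibmeet (plonka_zero i) (plonka_zero i)) by exists i.
have := stateD s h; rewrite ibjoinxx => /eqP.
by rewrite -subr_eq0 opprD addNKr oppr_eq0 => /eqP.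
Qed.

Lemma state_lift k a (ak : (tag a <= k)%O) : s (inFiber (lift_to ak)) = s a.
Proof.
have ka : (tag a `|` k)%O = k by apply/eqP; rewrite eq_joinr.
have je : ibjoin a (plonka_zero k) = inFiber (lift_to ak).
  apply: eq_lift_to => [|l h1 h2] //.
  rewrite (@lift_join _ _ S l a (plonka_zero k) h1 (le_trans ak h2) h2).
  rewrite lift_zero joinx0 {2}/lift_to /=.
  exact: lift_trans.
have me : ibmeet a (plonka_zero k) = plonka_zero k.
  apply: eq_lift_to => [|l h1 h2] //.
  rewrite (@lift_meet _ _ S l a (plonka_zero k) h1 (le_trans ak h2) h2).
  by rewrite lift_zero meetx0.
have h : is_zero (ibmeet a (plonka_zero k)) by exists k.
by rewrite -je (stateD s h) state_zero addr0.
Qed.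

Lemma PhiE a : Phi (bproj a) = s a.
Proof.
have /bproj_eq[k [ak [bk e]]] := bproj_repr (bproj a).
by rewrite /Phi -(state_lift ak) e state_lift.
Qed.

Lemma PhiT : Phi \top%O = 1.
Proof. by rewrite PhiE -(state1 s). Qed.

Lemma Phi0 : Phi \bot%O = 0.
Proof. by rewrite PhiE state_zero. Qed.

Lemma Phi_ge0 x : 0 <= Phi x.
Proof. by have /andP[] := state_itv s (repr x). Qed.

Lemma PhiD x y : (x `&` y)%O = \bot%O -> Phi (x `|` y)%O = Phi x + Phi y.
Proof.
rewrite -(bproj_repr x) -(bproj_repr y).
move: (repr x) (repr y) => a b.
rewrite -[(_ `&` _)%O]bproj_meet -[(_ `|` _)%O]bproj_join !PhiE.
move=> /bproj_eq[k [h [h' e]]].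
have := h; rewrite leUx => /andP[ak bk].
rewrite -(state_lift ak) -(state_lift bk) -stateD.
  rewrite -PhiE -[in RHS]PhiE; congr Phi.
  by rewrite !bproj_join -!bproj_lift.
exists k; apply: eq_lift_to => [|l l1 l2]; first exact: joinxx.
rewrite (@lift_meet _ _ S l (inFiber (lift_to ak)) (inFiber (lift_to bk)) l1 l2 l2).
rewrite lift_zero {1 2}/lift_to /=; have [<- _ _ b0 _] := bs_trans_morphism l2.
by rewrite -(lift_meet h ak bk) e lift_zero b0.
Qed.

Lemma le_Phi x y : (x <= y)%O -> Phi x <= Phi y.
Proof.
move=> xy; have -> : y = (x `|` (y `&` ~` x))%O.
  by rewrite joinIr joinxC meetx1; apply/esym/join_idPr.
by rewrite PhiD ?lerDl ?Phi_ge0 // meetCA meetxC meetx0.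
Qed.

Lemma Phi_subadd x y : Phi (x `|` y)%O <= Phi x + Phi y.
Proof.
have -> : (x `|` y = x `|` (y `&` ~` x))%O by rewrite joinIr joinxC meetx1.
by rewrite PhiD ?lerD2l ?le_Phi ?leIl // meetCA meetxC meetx0.
Qed.

Lemma bool_distxx x : bool_dist x x = 0.
Proof. by rewrite /bool_dist symdiffxx Phi0. Qed.

Lemma bool_dist_sym x y : bool_dist x y = bool_dist y x.
Proof. by rewrite /bool_dist symdiffC. Qed.

Lemma bool_dist_triangle y x z :
  bool_dist x z <= bool_dist x y + bool_dist y z.
Proof. exact: le_trans (le_Phi (symdiff_triangle y x z)) (Phi_subadd _ _). Qed.

Lemma bool_dist_bproj a b : bool_dist (bproj a) (bproj b) = state_dist a b.
Proof.
rewrite /state_dist -PhiE; congr Phi.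
by rewrite [RHS]bproj_join !bproj_meet !bproj_inv.
Qed.

Lemma state_distxx a : state_dist a a = 0.
Proof. by rewrite -bool_dist_bproj bool_distxx. Qed.

Lemma state_dist_sym a b : state_dist a b = state_dist b a.
Proof. by rewrite -!bool_dist_bproj bool_dist_sym. Qed.

Lemma state_dist_triangle b a c :
  state_dist a c <= state_dist a b + state_dist b c.
Proof. by rewrite -!bool_dist_bproj bool_dist_triangle. Qed.

End States.

Arguments state {d d'} S R.

Section Spaces.
Local Open Scope ring_scope.
Context {d d' : Order.disp_t} {S : booleanSystem d d'} {R : realType}.

(* The carriers [plonkaSum S] and [booleanisation S], with the topologies of
   [d_s] and [d_infty]. *)
Definition plonkaSpace (s : state S R) : Type := plonkaSum S.
Definition booleanisationSpace (s : state S R) : Type := booleanisation S.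

Variable s : state S R.

HB.instance Definition _ := Choice.on (plonkaSpace s).
HB.instance Definition _ := hasPseudodistance.Build R (plonkaSpace s)
  (state_distxx s) (state_dist_sym s) (state_dist_triangle s).

HB.instance Definition _ := Choice.on (booleanisationSpace s).
HB.instance Definition _ := hasPseudodistance.Build R (booleanisationSpace s)
  (bool_distxx s) (bool_dist_sym s) (bool_dist_triangle s).

Definition sproj : plonkaSpace s -> booleanisationSpace s := @bproj d d' S.

Lemma ball_plonkaSpace (a : plonkaSpace s) (e : R) :
  ball a e = [set b | state_dist s a b < e]%classic.
Proof. by []. Qed.

Lemma ball_booleanisationSpace (x : booleanisationSpace s) (e : R) :
  ball x e = [set y | bool_dist s x y < e]%classic.
Proof. by []. Qed.

Definition is_section (sigma : booleanisationSpace s -> plonkaSpace s) : Prop :=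
  continuous sigma /\ cancel sigma sproj.

End Spaces.

Arguments sproj {d d' S R} s _.
Arguments is_section {d d' S R} s sigma.

Section Projections.
Local Open Scope classical_set_scope.

Definition interior_preserving {X Y : topologicalType} (f : X -> Y) : Prop :=
  forall A : set X, interior (f @` A) = f @` interior A.

Definition saturated {X Y : Type} (f : X -> Y) (A : set X) : Prop :=
  A = f @^-1` (f @` A).

End Projections.

(* Main.v *)
(* The projection satisfies d_infty (pi a) (pi b) = d_s a b.  Hence it is a
   quotient map, every right inverse of it is a section, and the open and the
   closed subsets of B are saturated.  The range of a section meets every
   ~-class, so that it is saturated only if it is the whole of B, i.e. if every
   class is a singleton. *)
Require Import Defs.
From HB Require Import structures.
From mathcomp Require Import all_boot all_order all_algebra.
From mathcomp Require Import all_classical all_reals all_analysis.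

Set Implicit Arguments.
Unset Strict Implicit.
Unset Printing Implicit Defensive.

Local Open Scope classical_set_scope.

Section Projection.
Context {d d' : Order.disp_t} {S : booleanSystem d d'} {R : realType}.
Variable s : state S R.
Implicit Types (a b : plonkaSpace s) (A : set (plonkaSpace s)).
Implicit Types (x : booleanisationSpace s) (U : set (booleanisationSpace s)).
Implicit Type sigma : booleanisationSpace s -> plonkaSpace s.

Lemma ball_sproj a b (e : R) : ball (sproj s a) e (sproj s b) <-> ball a e b.
Proof. by rewrite ball_booleanisationSpace ball_plonkaSpace /= bool_dist_bproj. Qed.

Lemma sproj_repr : cancel (fun x => repr x : plonkaSpace s) (sproj s).
Proof. exact: bproj_repr. Qed.

Lemma nbhs_sproj a U : nbhs (sproj s a) U <-> nbhs a (sproj s @^-1` U).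
Proof.
split=> /nbhs_ballP[e e0 h]; apply/nbhs_ballP; exists e => //.
  by move=> b /ball_sproj/h.
(* Surjectivity: a point of the ball around [sproj s a] is the image of its representative, which
   lies in the ball around [a]. *)
by move=> x; rewrite -(sproj_repr x) => /ball_sproj/h.
Qed.

(** Continuity is automatic, because a right inverse of a distance-preserving map preserves
    distances. *)
Lemma right_inverse_section sigma : cancel sigma (sproj s) -> is_section s sigma.
Proof.
move=> sK; split=> // x A /nbhs_ballP[e e0 eA]; apply/nbhs_ballP.
by exists e => // y xy; apply/eA/ball_sproj; rewrite !sK.
Qed.

(** Points of one fiber are at distance zero, so every ball around [a] contains [b]. *)
Lemma nbhs_fiber a b A : sproj s a = sproj s b -> nbhs a A -> A b.
Proof.
move=> ab /nbhs_ballP[e e0]; apply; apply/ball_sproj; rewrite ab.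
exact: ballxx.
Qed.

Lemma open_saturated A : open A -> saturated (sproj s) A.
Proof.
rewrite openE => oA; apply/seteqP; split=> [|b [a Aa ab]].
  exact: preimage_image.
exact: nbhs_fiber ab (oA _ Aa).
Qed.

Lemma closed_saturated A : closed A -> saturated (sproj s) A.
Proof.
move=> /closed_openC; rewrite openE => oA; apply/seteqP; split=> [|b [a Aa ab]].
  exact: preimage_image.
(* If [b] lay in the open complement of [A], so would [a], which is in the same fiber. *)
by apply: contrapT => /oA /(nbhs_fiber (esym ab)); apply.
Qed.

Lemma range_section_saturated sigma : is_section s sigma ->
  saturated (sproj s) (range sigma) <-> range sigma = setT.
Proof.
move=> [_ sK]; split=> [->|->]; apply/seteqP; split=> //.
- by move=> a _; exists (sigma (sproj s a)); [exists (sproj s a)|exact: sK].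
- by move=> a _; exists a.
Qed.

Lemma range_section_clopen sigma : is_section s sigma ->
  [<-> open (range sigma); closed (range sigma);
       saturated (sproj s) (range sigma)].
Proof.
move=> hs; tfae.
(* Each condition forces the range to be the whole space, which is clopen. *)
- move=> /open_saturated/(range_section_saturated hs) ->; exact: closedT.
- exact: closed_saturated.
- move=> /(range_section_saturated hs) ->; exact: openT.
Qed.

(** Injectivity turns the preimage of the image of [A] back into [A], which gives the first
    inclusion; the second is openness of the projection. *)
Lemma bijective_interior_preserving :
  bijective (sproj s) -> interior_preserving (sproj s).
Proof.
move=> /bij_inj inj A; apply/seteqP; split=> [x|_ [a Aa <-]].
  rewrite -(sproj_repr x) => /nbhs_sproj Ax; exists (repr x) => //.
  by apply: filterS Ax => a [b Ab /inj <-].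
by apply/nbhs_sproj; apply: filterS Aa; exact: preimage_image.
Qed.

(** The range projects onto the whole space, so every [b] shares its fiber with an interior point of
    the range. *)
Lemma interior_preserving_range sigma : interior_preserving (sproj s) ->
  is_section s sigma -> range sigma = setT.
Proof.
move=> ip [_ sK]; apply/seteqP; split=> // b _.
have : interior (sproj s @` range sigma) (sproj s b).
  rewrite (_ : _ @` _ = setT) ?interiorT //.
  by apply/seteqP; split=> // x _; exists (sigma x) => //; exists x.
by rewrite ip => -[a Aa ab]; exact: nbhs_fiber ab Aa.
Qed.

End Projection.

Theorem theorem6p11 (d d' : Order.disp_t) (S : booleanSystem d d')
    (R : realType) (s : state S R) (s_faithful : faithful s) :
  [<-> bijective (sproj s);
       interior_preserving (sproj s);
       forall sigma, is_section s sigma -> open (range sigma);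
       forall sigma, is_section s sigma -> closed (range sigma);
       forall sigma, is_section s sigma -> saturated (sproj s) (range sigma)]
  /\ (forall sigma, is_section s sigma ->
      [<-> open (range sigma);
           closed (range sigma);
           saturated (sproj s) (range sigma)]).
Proof.
split; last exact: range_section_clopen.
tfae.
- exact: bijective_interior_preserving.
- move=> ip sigma hs; rewrite (interior_preserving_range ip hs); exact: openT.
- by move=> h sigma hs; apply/(range_section_clopen hs 0 1)/h.
- by move=> h sigma hs; apply/closed_saturated/h.
(* One section suffices: if the choice of representatives [repr] is onto, it is a two-sided inverse
   of the projection. *)
- move=> h; have hs := right_inverse_section (@sproj_repr _ _ _ _ s).
  have /(range_section_saturated hs) rT := h _ hs.
  exists (fun x => repr x); last exact: sproj_repr.
  by move=> a; have : setT a by []; rewrite -rT => -[x _ <-]; rewrite sproj_repr.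
Qed.
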